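(* Let $X=(x_{ij})$ be an $n\times n$ matrix of indeterminates over $\mathbb{Z}$, with $n\geqslant3$. Fix a prime $p>0$, let $\varphi_p$ be the standard $p$-derivation on $S=\mathbb{Z}[X]$ with respect to the entries of $X$, set $R=S/(\det X)$, and let $\mathfrak{a}=(x_{12},\dots,x_{1n},x_{22},\dots,x_{2n})R$. Then \[ \left[\frac{\varphi_p(\det X)}{(x_{12}\cdots x_{1n}x_{22}\cdots x_{2n})^p}\right]\in H^{2n-2}_{\mathfrak{a}}(R) \] is a nonzero $p$-torsion element, and its image in $H^{2n-2}_{\mathfrak{a}}(R/pR)$ is nonzero. In particular, $H^{2n-2}_{\mathfrak{a}}(R)$ contains a nonzero $p$-torsion element for each prime $p>0$.
   Context: For a polynomial ring $S=\mathbb{Z}[\boldsymbol{x}]$, the standard lift of Frobenius $\Lambda_p$ is the ring endomorphism with $\Lambda_p(x)=x^p$ for each indeterminate $x$, and the standard $p$-derivation is $\varphi_p(s)=(\Lambda_p(s)-s^p)/p$. The local cohomology class is the Čech class (on the $2n-2$ listed generators of $\mathfrak{a}$) of the image of $\varphi_p(\det X)$ in $R$. *)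

(* Defs.v *)
From HB Require Import structures.
From mathcomp Require Import all_boot all_order all_algebra.
From mathcomp Require Import mpoly.
Set Implicit Arguments. Unset Strict Implicit. Unset Printing Implicit Defensive.
Import GRing.Theory.
Local Open Scope ring_scope.

Definition in_ideal (R : comPzRingType) (gens : seq R) (f : R) : Prop :=
  exists cs : seq R, size cs = size gens /\
    f = \sum_(i < size gens) cs`_i * gens`_i.

(* Top local cohomology H^m_a(A), a = (y_1,...,y_m), A = R/(rel), computed as
   the Cech/direct-limit module  colim_t A/(y_1^t,...,y_m^t)  with transition
   maps multiplication by y_1...y_m.  The class [r/(y_1...y_m)^t] is the image
   of r in the t-th term; it vanishes iff for some k,
   (y_1...y_m)^k r \in (y_1^(t+k),...,y_m^(t+k)) A, i.e. in R modulo rel. *)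
Definition top_cech_class_zero (R : comPzRingType) (rel ys : seq R) (r : R)
    (t : nat) : Prop :=
  exists k : nat,
    in_ideal (rel ++ [seq y ^+ (t + k) | y <- ys]) ((\prod_(y <- ys) y) ^+ k * r).

Definition ZX (n : nat) := {mpoly int[n * n]}.

Definition xvar (n : nat) (i j : 'I_n) : ZX n := 'X_(mxvec_index i j).

Definition Xmat (n : nat) : 'M[ZX n]_n := \matrix_(i, j) xvar i j.

Definition Lambda (p n : nat) (s : ZX n) : ZX n :=
  comp_mpoly [tuple ('X_i : ZX n) ^+ p | i < n * n] s.

(* Standard p-derivation (Lambda s - s^p)/p, the division by p being
   performed coefficientwise (it is exact). *)
Definition phi_p (p n : nat) (s : ZX n) : ZX n :=
  map_mpoly (fun c : int => (c %/ (p%:Z))%Z) (Lambda p s - s ^+ p).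

(* Generators x_{12},...,x_{1n},x_{22},...,x_{2n} (1-indexed) of the ideal a:
   rows 0 and 1, columns 1..n-1 (0-indexed). *)
Definition agens (n : nat) : seq (ZX n) :=
  flatten [seq [seq xvar i j | j <- enum 'I_n & (0 < nat_of_ord j)%N]
          | i <- enum 'I_n & (nat_of_ord i < 2)%N].

(* Main.v *)
(* Since p * phi_p(s) = Lambda_p(s) - s^p, it is enough to understand p times the
   class. Here Lambda_p(det X) lies in the ideal of the p-th powers of the
   generators y of a, because a permutation cannot send both of the first two
   rows to the first column. This gives p-torsion, and it turns the vanishing of
   the class modulo p into Y^k (det X)^p + p h det X \in (p^2, y^(p+k) : y) for
   some h, with Y the product of the y.

   Specialise row 3 to (0, x, y, 0, ...) and row i >= 4 to the i-th unit vector,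
   so that det X becomes D = b x u2 + a y v1 - b y u1 - a x v2, where
   (a, u1, u2) and (b, v1, v2) start rows 1 and 2. The ideal J generated by the
   (2p-1)-st powers of a, b, x, y and the (p+k)-th powers of the generators is
   monomial, with a largest surviving monomial T. There is an explicit g with
   g D \in J + (p), while Y^k g D^p is congruent modulo J to
   - (2p-1) C(2p-2, p-1) T, and p^2 does not divide that coefficient. *)
Require Import Defs.
From HB Require Import structures.
From mathcomp Require Import all_boot all_order all_algebra.
From mathcomp Require Import mpoly.
From mathcomp Require Import perm ring zify.
Import GRing.Theory.
Set Implicit Arguments. Unset Strict Implicit. Unset Printing Implicit Defensive.
Local Open Scope ring_scope.

(** * Ideals as predicates *)

(** Predicates rather than generator lists, so that colon ideals and preimages under substitutions
    are covered as well. *)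
Definition ideal_pred (R : comPzRingType) (I : R -> Prop) :=
  [/\ I 0, forall f g, I f -> I g -> I (f + g) & forall c f, I f -> I (c * f)].

Section IdealPredicates.
Context (R : comPzRingType) (I : R -> Prop) (idI : ideal_pred I).

Lemma ideal_pred0 : I 0. Proof. by case: idI. Qed.

Lemma ideal_predD f g : I f -> I g -> I (f + g).
Proof. by case: idI => _ + _; apply. Qed.

Lemma ideal_predM c f : I f -> I (c * f).
Proof. by case: idI => _ _; apply. Qed.

Lemma ideal_predMr f c : I f -> I (f * c).
Proof. by rewrite mulrC; apply: ideal_predM. Qed.

Lemma ideal_predN f : I f -> I (- f).
Proof. by rewrite -mulN1r; apply: ideal_predM. Qed.

Lemma ideal_predB f g : I f -> I g -> I (f - g).
Proof. by move=> If Ig; apply: ideal_predD => //; apply: ideal_predN. Qed.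

Lemma ideal_pred_sum (J : Type) (s : seq J) (P : pred J) (F : J -> R) :
  (forall j, P j -> I (F j)) -> I (\sum_(j <- s | P j) F j).
Proof. by apply: big_ind; [exact: ideal_pred0 | exact: ideal_predD]. Qed.

Lemma ideal_pred_subr f g : I g -> I (f - g) -> I f.
Proof. by move=> Ig Ifg; rewrite -(subrK g f); apply: ideal_predD. Qed.

Lemma in_ideal_sub (gens : seq R) f :
  (forall g, g \in gens -> I g) -> in_ideal gens f -> I f.
Proof.
move=> genI [cs [_ ->]]; apply: ideal_pred_sum => i _.
by apply/ideal_predM/genI/mem_nth.
Qed.

Lemma ideal_pred_expr_ge c A e n :
  (e <= n)%N -> I (c * A ^+ e) -> I (c * A ^+ n).
Proof.
by move=> le_en IA; rewrite -(subnKC le_en) exprD mulrA; apply: ideal_predMr.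
Qed.

Lemma ideal_pred_exprDn_term c A B e f i j : (e <= i)%N || (f <= j)%N ->
  I (c * A ^+ e) -> I (c * B ^+ f) -> I (c * (A ^+ i * B ^+ j)).
Proof.
case/orP=> [ei IA _|fj _ IB].
  by rewrite mulrA; apply: ideal_predMr; apply: ideal_pred_expr_ge IA.
by rewrite mulrCA; apply: ideal_predM; apply: ideal_pred_expr_ge IB.
Qed.

(** Pigeonhole: in each binomial term A^i B^j with i + j = n, either i >= e or j >= f. The factor
    [c] is carried along because later only c A^e and c B^f are known to lie in the ideal. *)
Lemma ideal_pred_exprDn c A B e f n : (e + f <= n.+1)%N ->
  I (c * A ^+ e) -> I (c * B ^+ f) -> I (c * (A + B) ^+ n).
Proof.
move=> len IA IB; rewrite exprDn mulr_sumr; apply: ideal_pred_sum => i _.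
rewrite mulrnAr -mulr_natl; apply: ideal_predM.
by apply: ideal_pred_exprDn_term IA IB; lia.
Qed.

(** Every term of the binomial expansion other than the middle one has an exponent above m. *)
Lemma ideal_pred_exprDn_middle c A B m :
  I (c * A ^+ m.+1) -> I (c * B ^+ m.+1) ->
  I (c * ((A + B) ^+ m.*2 - (A * B) ^+ m *+ 'C(m.*2, m))).
Proof.
move=> IA IB; have mm : (m < (m.*2).+1)%N by lia.
rewrite exprDn (bigD1 (Ordinal mm)) //=.
rewrite -{1}addnn addnK -exprMn addrAC subrr add0r mulr_sumr.
apply: ideal_pred_sum => i; rewrite -val_eqE /= => im.
rewrite mulrnAr -mulr_natl; apply: ideal_predM.
by apply: ideal_pred_exprDn_term IA IB; lia.
Qed.

End IdealPredicates.

(** * Finitely generated ideals *)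

Section InIdeal.
Context (R : comPzRingType).

Lemma in_ideal_pred (gens : seq R) : ideal_pred (in_ideal gens).
Proof.
split.
- exists (nseq (size gens) 0); rewrite size_nseq; split=> //.
  by rewrite big1 // => i _; rewrite nth_nseq if_same mul0r.
- move=> _ _ [cs [_ ->]] [ds [_ ->]].
  exists (mkseq (fun i => cs`_i + ds`_i) (size gens)); rewrite size_mkseq.
  split=> //; rewrite -big_split; apply: eq_bigr => i _ /=.
  by rewrite nth_mkseq // mulrDl.
- move=> c _ [cs [_ ->]].
  exists (mkseq (fun i => c * cs`_i) (size gens)); rewrite size_mkseq.
  split=> //; rewrite mulr_sumr; apply: eq_bigr => i _ /=.
  by rewrite nth_mkseq // mulrA.
Qed.

Lemma in_ideal_mem (gens : seq R) g : g \in gens -> in_ideal gens g.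
Proof.
move=> gG; exists (mkseq (fun i => (i == index g gens)%:R) (size gens)).
rewrite size_mkseq; split=> //.
have lt_ig : (index g gens < size gens)%N by rewrite index_mem.
rewrite (bigD1 (Ordinal lt_ig)) //= nth_mkseq // eqxx mul1r nth_index //.
rewrite big1 ?addr0 // => i; rewrite -val_eqE /= => /negPf ine.
by rewrite nth_mkseq // ine mul0r.
Qed.

End InIdeal.

(** * Powers of sums: expansions to low order and modulo p *)

Section PowersOfSums.
Context (R : comPzRingType).
Implicit Types a b : R.

Lemma exprD_modr a b n : exists r, (a + b) ^+ n = a ^+ n + b * r.
Proof.
elim: n => [|n [r IH]]; first by exists 0; rewrite !expr0; ring.
by exists (a ^+ n + (a + b) * r); rewrite exprSr IH exprSr; ring.
Qed.

Lemma exprD_modr2 a b n :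
  exists r, (a + b) ^+ n.+1 = a ^+ n.+1 + n.+1%:R * (a ^+ n * b) + b ^+ 2 * r.
Proof.
elim: n => [|n [r IH]]; first by exists 0; rewrite !expr1 expr0; ring.
exists (n.+1%:R * a ^+ n + (a + b) * r).
by rewrite exprSr IH [in RHS]exprSr -(natr1 n.+1) (exprSr a n); ring.
Qed.

Context (p : nat) (p_pr : prime p).

Lemma exprD_prime a b : exists r, (a + b) ^+ p = a ^+ p + b ^+ p + p%:R * r.
Proof.
case: p p_pr => // m pr_m; rewrite exprDn big_ord_recl big_ord_recr /=.
rewrite subn0 /bump /= add1n subnn bin0 binn !expr0 !mulr1n mulr1 mul1r.
(* Each inner binomial coefficient is divided by p as a natural number, since p may be a zero
   divisor in R. *)
exists (\sum_(i < m) (a ^+ (m - i) * b ^+ i.+1) *+ ('C(m.+1, i.+1) %/ m.+1)).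
rewrite mulr_sumr -addrA; congr (_ + _); rewrite addrC; congr (_ + _).
apply: eq_bigr => i _; rewrite add1n subSS mulrnAr mulr_natl -mulrnA mulnC.
by rewrite divnK // prime_dvd_bin //=; apply: ltn_ord.
Qed.

(** Read off from (a + (-a))^p = 0, which treats p = 2 and odd p alike. *)
Lemma exprN_prime a : exists r, (- a) ^+ p = - a ^+ p + p%:R * r.
Proof.
have [r /esym E] := exprD_prime a (- a); exists (- r).
have {}E : a ^+ p + (- a) ^+ p + p%:R * r = 0.
  by rewrite E subrr expr0n gtn_eqF ?prime_gt0.
by rewrite mulrN -[LHS]subr0 -E; ring.
Qed.

End PowersOfSums.

(** * The multiplier g of the specialised determinant D *)

Section AlgebraicCore.
Context (R : comPzRingType) (q : nat).
Context (a b x y u1 u2 v1 v2 : R).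
Let D := b * x * u2 + a * y * v1 - b * y * u1 - a * x * v2.

(** Here p = q + 2, so p - 2, p - 1 and 2p - 1 appear as [q], [q.+1] and [(q.+1).*2.+1]. The
    exponents are such that c0 times the p-th power of a term of D contains a^(2p-1) or x^(2p-1),
    except for the term b y u1. *)
Let c0 := u1 ^+ q * v2 ^+ q.+1 * (a * x) ^+ q.+1 * (b * y) ^+ q.

(* Found by Macaulay duality: in the variables u1/ax, u2/ay, v1/bx, v2/by the
   specialised determinant is a b x y times a linear form. *)
Definition multiplier :=
  c0 * D ^+ q.+1 - (b * y * u1) ^+ (q.+1).*2 * (a * x * v2) ^+ q.

Lemma multiplier_kills (I : R -> Prop) (idI : ideal_pred I) :
  prime q.+2 -> I q.+2%:R ->
  I (a ^+ (q.+1).*2.+1) -> I (b ^+ (q.+1).*2.+1) ->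
  I (x ^+ (q.+1).*2.+1) -> I (y ^+ (q.+1).*2.+1) -> I (multiplier * D).
Proof.
move=> p_pr Ip Ia Ib Ix Iy.
(* Modulo p, D^p is the signed sum of the p-th powers of its four terms. *)
have [r3 E3] := exprD_prime p_pr (b * x * u2 + a * y * v1 - b * y * u1)
                  (- (a * x * v2)).
have [r2 E2] := exprD_prime p_pr (b * x * u2 + a * y * v1) (- (b * y * u1)).
have [r1 E1] := exprD_prime p_pr (b * x * u2) (a * y * v1).
have [s1 F1] := exprN_prime p_pr (b * y * u1).
have [s2 F2] := exprN_prime p_pr (a * x * v2).
have ED : D ^+ q.+2 = (b * x * u2) ^+ q.+2 + (a * y * v1) ^+ q.+2
   - (b * y * u1) ^+ q.+2 - (a * x * v2) ^+ q.+2
   + q.+2%:R * (r1 + r2 + r3 + s1 + s2).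
  by rewrite /D E3 E2 E1 F1 F2; ring.
have -> : multiplier * D = c0 * D ^+ q.+2
   - (b * y * u1) ^+ (q.+1).*2 * (a * x * v2) ^+ q * D.
  by rewrite /multiplier mulrBl (exprSr D q.+1) mulrA.
rewrite ED /D /c0 {E3 E2 E1 F1 F2 ED}.
move: (r1 + r2 + r3 + s1 + s2) Ip => r Ip.
move: Ia Ib Ix Iy Ip; rewrite -addnn !exprMn -!addnS !exprD !exprSr.
(* The q-th powers become independent variables, which leaves a polynomial identity for [ring]. *)
move: (a ^+ q) (b ^+ q) (x ^+ q) (y ^+ q)
  (u1 ^+ q) (u2 ^+ q) (v1 ^+ q) (v2 ^+ q)
  => aq bq xq yq u1q u2q v1q v2q Ia Ib Ix Iy Ip.
set A := aq * a * _ in Ia; set B := bq * b * _ in Ib.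
set X := xq * x * _ in Ix; set Y := yq * y * _ in Iy.
set Q := q.+2%:R in Ip *.
set w := u1q * (v2q * v2); set P := bq * b * (bq * b) * (u1q * u1 * (u1q * u1)).
set P' := yq * y * (yq * y) * (u1q * u1 * (u1q * u1)).
pose k4 := aq * xq * v2q.
(* The surviving term c0 (b y u1)^p cancels against the a x v2 term of D in the second summand of
   the multiplier; each other term of that summand contains b^(2p-1) or y^(2p-1). *)
rewrite [X in I X](_ : _ =
  X * (w * (aq * a) * (bq * yq) * (bq * b * b) * (u2q * u2 * u2))
  + A * (w * (xq * x) * (bq * yq) * (yq * y * y) * (v1q * v1 * v1))
  - A * (w * (xq * x) * (bq * yq) * (xq * x * x) * (v2q * v2 * v2))
  + Q * (w * (aq * a * (xq * x)) * (bq * yq) * r)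
  - B * (P' * k4 * (x * u2 - y * u1)) - Y * (P * k4 * (a * v1))).
  by do ![apply: ideal_predB => // | apply: ideal_predD => //];
    apply: ideal_predMr.
rewrite /A /B /X /Y /Q /w /P /P' /k4; ring.
Qed.

Context (k : nat).

Lemma multiplier_top_term (I : R -> Prop) (idI : ideal_pred I) :
  I (u1 ^+ (q.+2 + k)) -> I (u2 ^+ (q.+2 + k)) ->
  I (v1 ^+ (q.+2 + k)) -> I (v2 ^+ (q.+2 + k)) ->
  I ((u1 * u2 * v1 * v2) ^+ k * (multiplier * D ^+ q.+2)
     + ((q.+1).*2.+1 * 'C((q.+1).*2, q.+1))%:R *
       ((a * b * x * y) ^+ (q.+1).*2 * (u1 * u2 * v1 * v2) ^+ (q.+1 + k))).
Proof.
move=> Iu1 Iu2 Iv1 Iv2; set c := (u1 * u2 * v1 * v2) ^+ k.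
set P1 := b * x * u2; set P2 := a * y * v1; set P3 := b * y * u1.
set P4 := a * x * v2; set n := (q.+1).*2; set F := P1 + P2.
have IP1 : I (c * P1 ^+ q.+2).
  rewrite [X in I X](_ : _ = (b * x) ^+ q.+2 * (u1 * v1 * v2) ^+ k
                             * u2 ^+ (q.+2 + k));
    first exact: ideal_predM.
  by rewrite /c /P1 exprD !exprMn; ring.
have IP2 : I (c * P2 ^+ q.+2).
  rewrite [X in I X](_ : _ = (a * y) ^+ q.+2 * (u1 * u2 * v2) ^+ k
                             * v1 ^+ (q.+2 + k));
    first exact: ideal_predM.
  by rewrite /c /P2 exprD !exprMn; ring.
have I1 : I (c * P3 ^+ n).
  apply: (@ideal_pred_expr_ge _ _ idI _ _ q.+2); first by rewrite /n; lia.
  rewrite [X in I X](_ : _ = (b * y) ^+ q.+2 * (u2 * v1 * v2) ^+ k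
                             * u1 ^+ (q.+2 + k));
    first exact: ideal_predM.
  by rewrite /c /P3 exprD !exprMn; ring.
have I2 : I (c * c0 * P4).
  rewrite [X in I X](_ : _ = (u1 * u2 * v1) ^+ k * u1 ^+ q * (a * x) ^+ q.+2
                      * (b * y) ^+ q * v2 ^+ (q.+2 + k));
    first exact: ideal_predM.
  by rewrite /c /c0 /P4 exprD !exprMn !exprSr; ring.
have I3 : I (c * c0 * P3 ^+ 2).
  rewrite [X in I X](_ : _ = (u2 * v1 * v2) ^+ k * v2 ^+ q.+1 * (a * x) ^+ q.+1
                      * (b * y) ^+ q.+2 * u1 ^+ (q.+2 + k));
    first exact: ideal_predM.
  by rewrite /c /c0 /P3 exprD !exprMn !exprSr; ring.
have I4 : I (c * F ^+ n.+1).
  by apply: (ideal_pred_exprDn idI) IP1 IP2; rewrite /n; lia.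
have I5 := ideal_pred_exprDn_middle idI IP1 IP2.
have [r4 E4] := exprD_modr (F - P3) (- P4) n.+1.
have [r3 E3] := exprD_modr2 F (- P3) n.
have En : D ^+ q.+1 * D ^+ q.+2 = D ^+ n.+1.
  by rewrite -exprD /n; congr (_ ^+ _); lia.
(* Modulo I, c c0 kills P4 and P3^2, so D^(n+1) reduces to F^(n+1) - (n+1) F^n P3. Here c F^(n+1)
   vanishes and c F^n reduces to its middle binomial term. The second summand of the multiplier dies
   because c P3^n lies in I. *)
rewrite [X in I X](_ : _ = c0 * (c * F ^+ n.+1)
   - n.+1%:R * c0 * P3
     * (c * (F ^+ n - (P1 * P2) ^+ q.+1 *+ 'C((q.+1).*2, q.+1)))
   + r3 * (c * c0 * P3 ^+ 2) - r4 * (c * c0 * P4)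
   - (P4 ^+ q * D ^+ q.+2) * (c * P3 ^+ n)).
  by do ![apply: ideal_predB => // | apply: ideal_predD => //];
    apply: ideal_predM.
have -> : c * (multiplier * D ^+ q.+2) =
    c * c0 * D ^+ n.+1 - c * P3 ^+ n * P4 ^+ q * D ^+ q.+2.
  rewrite -En /multiplier -/P3 -/P4 -/n; ring.
rewrite {1}/D -/P1 -/P2 -/P3 -/P4 -/F E4 E3.
have -> : (a * b * x * y) ^+ n * (u1 * u2 * v1 * v2) ^+ (q.+1 + k) =
    c * c0 * P3 * (P1 * P2) ^+ q.+1.
  rewrite /n -addnn !exprD /c /c0 /P1 /P2 /P3 !exprMn !exprSr; ring.
rewrite natrM -mulr_natr; ring.
Qed.

(** With w the product of the generators other than u1, u2, v1, v2, the factor w^(p-1) gives them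
    the exponent p - 1 + k as well. *)
Lemma multiplier_top_term_ext (I : R -> Prop) (idI : ideal_pred I) (w : R) :
  I (u1 ^+ (q.+2 + k)) -> I (u2 ^+ (q.+2 + k)) ->
  I (v1 ^+ (q.+2 + k)) -> I (v2 ^+ (q.+2 + k)) ->
  I ((u1 * u2 * v1 * v2 * w) ^+ k * (multiplier * w ^+ q.+1 * D ^+ q.+2)
     + ((q.+1).*2.+1 * 'C((q.+1).*2, q.+1))%:R *
       ((a * b * x * y) ^+ (q.+1).*2
        * (u1 * u2 * v1 * v2 * w) ^+ (q.+1 + k))).
Proof.
move=> Iu1 Iu2 Iv1 Iv2; have := multiplier_top_term idI Iu1 Iu2 Iv1 Iv2.
move: (multiplier) (D ^+ _) (_%:R) (u1 * u2 * v1 * v2) => g d N u.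
move/(ideal_predMr idI (w ^+ (q.+1 + k))).
by congr (I _); rewrite !exprMn !exprD; ring.
Qed.

End AlgebraicCore.

(** The coefficient equals p C(2p-1, p-1), and (p-1)! C(2p-1, p-1) is the product of the integers
    from p + 1 to 2p - 1, none of them divisible by p. *)
Lemma prime_sqr_ndvd_top_coef q : prime q.+2 ->
  ~~ (q.+2 * q.+2 %| (q.+1).*2.+1 * 'C((q.+1).*2, q.+1))%N.
Proof.
move=> p_pr; have := mul_bin_diag (q.+1).*2.+1 q.+1; rewrite succnK => ->.
rewrite dvdn_pmul2l // -bin_sub; last lia.
have -> : ((q.+1).*2.+1 - q.+2 = q.+1)%N by lia.
apply/negP => /(dvdn_mulr q.+1`!); rewrite bin_ffact ffact_prod.
rewrite Euclid_dvd_prod // big_has => /hasP[i _] /dvdnP[c].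
by have := ltn_ord i; case: c => [|[|c]]; nia.
Qed.

(** * Monomial ideals plus an integer, tested on coefficients *)

Section CoefficientIdeal.
Context (n : nat) (M : 'X_{1..n}).
Implicit Types (d e : nat) (f : {mpoly int[n]}).

(* The ideal generated by d and the monomials that do not divide M. *)
Definition coef_dvd d f := forall m, (m <= M)%MM -> (d%:Z %| f@_m)%Z.

(** Factors of a divisor of M again divide M, so the coefficient of c f at such a monomial involves
    only coefficients of f at divisors of M. *)
Lemma coef_dvd_ideal d : ideal_pred (coef_dvd d).
Proof.
split=> [m _|f g df dg m mM|c f df m mM].
- by rewrite mcoeff0 dvdz0.
- by rewrite mcoeffD rpredD ?df ?dg.
rewrite mcoeffM rpred_sum // => k /eqP mE; apply/dvdz_mull/df.
by apply: lepm_trans mM; rewrite [X in (_ <= X)%MM]mE lem_addl.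
Qed.

Lemma coef_dvd_Xn d i e : (M i < e)%N -> coef_dvd d ('X_i ^+ e).
Proof.
move=> Mi m /mnm_lepP/(_ i) mM; rewrite mcoeffXn; case: eqP => // mE.
by move: mM; rewrite -mE mulmnE mnm1E eqxx mul1n leqNgt Mi.
Qed.

Lemma coef_dvd_natM d e f : coef_dvd d f -> coef_dvd (e * d) (e%:R * f).
Proof.
move=> df m mM; rewrite mulr_natl mcoeffMn -mulr_natl PoszM.
by rewrite pmulrn intz dvdz_mul // df.
Qed.

Lemma coef_dvd_nat d : coef_dvd d d%:R.
Proof.
rewrite -[X in coef_dvd X](muln1 d) -[X in coef_dvd _ X]mulr1.
by apply: coef_dvd_natM => m _; rewrite dvd1z.
Qed.

Lemma coef_dvd_top d c : coef_dvd d (c%:R * 'X_[M]) -> (d %| c)%N.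
Proof.
move/(_ M (lepm_refl _)); rewrite mulr_natl mcoeffMn mcoeffX eqxx.
by rewrite pmulrn intz.
Qed.

End CoefficientIdeal.

(** * The Frobenius lift and the p-derivation *)

Section FrobeniusLift.
Context (n p : nat) (p_pr : prime p).
Local Notation Lambda := (@Lambda p n).

Lemma LambdaD s t : Lambda (s + t) = Lambda s + Lambda t.
Proof. exact: comp_mpolyD. Qed.

Lemma LambdaN s : Lambda (- s) = - Lambda s.
Proof. exact: comp_mpolyN. Qed.

Lemma LambdaM s t : Lambda (s * t) = Lambda s * Lambda t.
Proof. exact: rmorphM. Qed.

Lemma LambdaXU (l : 'I_(n * n)) : Lambda 'X_l = 'X_l ^+ p.
Proof. by rewrite /Lambda comp_mpolyXU -tnth_nth tnth_mktuple. Qed.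

Let frob (s : ZX n) := exists r, Lambda s = s ^+ p + p%:R * r.

Let frobD s t : frob s -> frob t -> frob (s + t).
Proof.
move=> [r Es] [r' Et]; have [r'' E] := exprD_prime p_pr s t.
by exists (r + r' - r''); rewrite LambdaD Es Et E; ring.
Qed.

Let frobM s t : frob s -> frob t -> frob (s * t).
Proof.
move=> [r Es] [r' Et]; exists (r * t ^+ p + s ^+ p * r' + p%:R * (r * r')).
by rewrite LambdaM Es Et exprMn; ring.
Qed.

Let frobN s : frob s -> frob (- s).
Proof.
move=> [r Es]; have [r' E] := exprN_prime p_pr s; exists (- r - r').
by rewrite LambdaN Es E; ring.
Qed.

Let frob0 : frob 0.
Proof.
by exists 0; rewrite mulr0 addr0 expr0n gtn_eqF ?prime_gt0 ?[LHS]comp_mpoly0.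
Qed.

Let frob1 : frob 1.
Proof. by exists 0; rewrite mulr0 addr0 expr1n [LHS]comp_mpoly1. Qed.

(** The polynomials satisfying the congruence form a subring containing every indeterminate. *)
Lemma Lambda_frobenius s : exists r, Lambda s = s ^+ p + p%:R * r.
Proof.
rewrite -/(frob s) (mpolyE s); apply: big_ind => [||m _] //.
rewrite -mul_mpolyC; apply: frobM.
  have frob_nat c : frob c%:R.
    by elim: c => [|c IH] //; rewrite -natr1; apply: frobD.
  by case: s@_m => c; rewrite ?NegzE ?mpolyCN -[Posz _]intz -pmulrn mpolyC_nat;
    rewrite //; apply: frobN.
rewrite mpolyXE_id; apply: big_ind => // l _.
elim: (m l) => [|c IH]; first by rewrite expr0.
rewrite exprS; apply: frobM => //.
by exists 0; rewrite LambdaXU; ring.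
Qed.

(** By the congruence every coefficient of the difference is a multiple of p, so the coefficientwise
    division is exact. *)
Lemma phi_pE s : p%:R * phi_p p s = Lambda s - s ^+ p.
Proof.
have [r E] := Lambda_frobenius s.
rewrite /phi_p E [_ + _ - _]addrAC subrr add0r /map_mpoly /mmap mulr_sumr.
rewrite [RHS]mpolyE; apply: eq_bigr => m _.
rewrite /mmap1 -mpolyXE_id mulrA /= -mpolyC_nat -mpolyCM -mul_mpolyC.
congr (_%:MP * _); rewrite mul_mpolyC mcoeffZ.
by rewrite [p%:R]pmulrn intz mulrC divzK // dvdz_mulr.
Qed.

End FrobeniusLift.

(** * The generators of the ideal, the generic determinant and matrix substitutions *)

Section Determinant.
Context (n : nat).

Lemma mem_agens (i j : 'I_n) : (i < 2)%N -> (0 < j)%N -> xvar i j \in agens n.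
Proof.
move=> i2 j0; apply/flattenP.
exists [seq xvar i j' | j' <- enum 'I_n & (0 < nat_of_ord j')%N].
  by apply: map_f; rewrite mem_filter i2 mem_enum.
by apply: map_f; rewrite mem_filter j0 mem_enum.
Qed.

Lemma agensP y : y \in agens n ->
  exists i j : 'I_n, [/\ (i < 2)%N, (0 < j)%N & y = xvar i j].
Proof.
case/flattenP=> _ /mapP[i + ->] /mapP[j + ->]; rewrite !mem_filter.
by move=> /andP[i2 _] /andP[j0 _]; exists i, j.
Qed.

Lemma prod_agens : \prod_(y <- agens n) y =
  \prod_(i < n | (i < 2)%N) \prod_(j < n | (0 < j)%N) xvar i j.
Proof.
rewrite big_flatten big_map big_filter big_enum_cond /=.
by apply: eq_bigr => i _; rewrite big_map big_filter big_enum_cond.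
Qed.

(** Used with c = 1 for the torsion statement and with c = Y^k for the nonvanishing. *)
Lemma Lambda_det_ideal (p : nat) (I : ZX n -> Prop) (c : ZX n) :
  (1 < n)%N -> ideal_pred I -> (forall y, y \in agens n -> I (c * y ^+ p)) ->
  I (c * Lambda p (\det (Xmat n))).
Proof.
move=> n_gt1 idI Iy; pose i0 := Ordinal (ltnW n_gt1); pose i1 := Ordinal n_gt1.
rewrite /Lambda -det_map_mx mulr_sumr; apply: ideal_pred_sum => // s _.
have [i i2 si] : exists2 i : 'I_n, (i < 2)%N & (0 < s i)%N.
  have [s0|] := posnP (s i0); last by exists i0.
  exists i1; rewrite // lt0n; apply/eqP => s1.
  have /perm_inj/(congr1 val)// : s i0 = s i1.
  by apply: val_inj; rewrite /= s0 s1.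
rewrite mulrCA; apply: (ideal_predM idI).
rewrite (bigD1 i) //= mulrA; apply: (ideal_predMr idI).
rewrite !mxE [comp_mpoly _ _]LambdaXU; exact/Iy/mem_agens.
Qed.

Lemma mxvec_index_eq (i j i' j' : 'I_n) :
  (mxvec_index i j == mxvec_index i' j') = (i == i') && (j == j').
Proof.
by rewrite /mxvec_index (inj_eq (@cast_ord_inj _ _ _)) (inj_eq enum_rank_inj).
Qed.

Definition matrix_subst (S : 'M[ZX n]_n) : ZX n -> ZX n :=
  comp_mpoly [tuple mxvec S 0 l | l < n * n].

Lemma matrix_subst_xvar S (i j : 'I_n) : matrix_subst S (xvar i j) = S i j.
Proof.
by rewrite /matrix_subst comp_mpolyXU -tnth_nth tnth_mktuple mxvecE.
Qed.

Lemma matrix_subst_det S : matrix_subst S (\det (Xmat n)) = \det S.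
Proof.
rewrite /matrix_subst -det_map_mx; congr (\det _).
by apply/matrixP => i j; rewrite !mxE [LHS]matrix_subst_xvar.
Qed.

HB.instance Definition _ S := GRing.RMorphism.on (matrix_subst S).

End Determinant.

(** * The specialised matrix and the top monomial *)

Lemma det_mx33 (R : comPzRingType) (f : nat -> nat -> R) :
  \det (\matrix_(i < 3, j < 3) f i j) =
  f 0 0 * (f 1 1 * f 2 2 - f 1 2 * f 2 1)
  - f 0 1 * (f 1 0 * f 2 2 - f 1 2 * f 2 0)
  + f 0 2 * (f 1 0 * f 2 1 - f 1 1 * f 2 0).
Proof.
rewrite (expand_det_row _ ord0) !big_ord_recl big_ord0 /cofactor.
rewrite !(expand_det_row _ ord0) !big_ord_recl !big_ord0 /cofactor !det_mx11.
rewrite !mxE /= /bump /= !exprS !expr0; ring.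
Qed.

Section Specialization.
Context (m : nat).
Local Notation n := (m.+3).
Let i0 : 'I_n := Ordinal (isT : 0 < n)%N.
Let i1 : 'I_n := Ordinal (isT : 1 < n)%N.
Let i2 : 'I_n := Ordinal (isT : 2 < n)%N.

(** The first two rows stay generic, so the substitution fixes every generator of the ideal. *)
Definition special_mx : 'M[ZX n]_n := \matrix_(i, j)
  if (i < 2)%N then xvar i j else
  if i == 2 :> nat then (if (0 < j < 3)%N then xvar i j else 0) else
  (i == j)%:R.

Let D : ZX n :=
  xvar i1 i0 * xvar i2 i1 * xvar i0 i2 + xvar i0 i0 * xvar i2 i2 * xvar i1 i1
  - xvar i1 i0 * xvar i2 i2 * xvar i0 i1 - xvar i0 i0 * xvar i2 i1 * xvar i1 i2.

(** The matrix is block upper triangular with an identity block at the lower right, so only the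
    leading 3 by 3 block counts. *)
Lemma det_special_mx : \det special_mx = D.
Proof.
have dlE : @dlsubmx _ 3 m 3 m special_mx = 0.
  apply/matrixP => i j; rewrite !mxE /= -val_eqE /=.
  by have := ltn_ord j; case: eqP => //; lia.
have drE : @drsubmx _ 3 m 3 m special_mx = 1%:M.
  by apply/matrixP => i j; rewrite !mxE /= -val_eqE /= eqn_add2l.
have -> : \det special_mx = \det (@ulsubmx _ 3 m 3 m special_mx).
  rewrite -[RHS]mulr1 -[X in _ * X](det1 _ m).
  by rewrite -(det_ublock _ (@ursubmx _ 3 m 3 m special_mx)) -dlE -drE submxK.
pose f (i j : nat) : ZX n := special_mx (inord i) (inord j).
have -> : @ulsubmx _ 3 m 3 m special_mx = \matrix_(i < 3, j < 3) f i j.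
  apply/matrixP => i j; rewrite [LHS]mxE [LHS]mxE [RHS]mxE /f.
  by congr (special_mx _ _); apply: val_inj; rewrite /= inordK //;
    apply: leq_trans (ltn_ord _) _.
have [E0 E1 E2] : [/\ inord 0 = i0, inord 1 = i1 & inord 2 = i2].
  by split; apply: val_inj; rewrite /= inordK.
by rewrite det_mx33 /f E0 E1 E2 !mxE /= /D; ring.
Qed.

Context (e f : nat).

Let agens_mnm : 'X_{1..n * n} :=
  (\sum_(i < n | (i < 2)%N) \sum_(j < n | (0 < j)%N) U_(mxvec_index i j))%MM.

(** Used with e = 2p - 2 and f = p - 1 + k. Indeterminates other than a, b, x, y and the generators
    get exponent 0, so they belong to the associated monomial ideal. *)
Definition top_mnm : 'X_{1..n * n} :=
  ((U_(mxvec_index i0 i0) + U_(mxvec_index i1 i0)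
    + U_(mxvec_index i2 i1) + U_(mxvec_index i2 i2)) *+ e + agens_mnm *+ f)%MM.

Lemma top_mnmE : 'X_[top_mnm] =
  (xvar i0 i0 * xvar i1 i0 * xvar i2 i1 * xvar i2 i2) ^+ e
  * (\prod_(y <- agens n) y) ^+ f.
Proof.
rewrite prod_agens mpolyXD -!mpolyXn !mpolyXD; congr (_ * _ ^+ _).
by rewrite -mprodXE; apply: eq_bigr => i _; rewrite -mprodXE.
Qed.

Lemma agens_mnmE (i j : 'I_n) :
  agens_mnm (mxvec_index i j) = (i < 2)%N && (0 < j)%N.
Proof.
rewrite /agens_mnm mnm_sumE.
under eq_bigr => i' _.
  rewrite mnm_sumE.
  under eq_bigr => j' _ do rewrite mnm1E mxvec_index_eq -mulnb.
  rewrite -big_distrr big_mkcond (bigD1 j) //= eqxx big1 ?addn0; last first.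
    by move=> j' /negPf ->; rewrite if_same.
  over.
rewrite big_mkcond (bigD1 i) //= eqxx mul1n big1 ?addn0; last first.
  by move=> i' /negPf ->; rewrite mul0n if_same.
by case: (i < 2)%N; case: (0 < j)%N.
Qed.

Lemma top_mnm_agens (i j : 'I_n) :
  (i < 2)%N -> (0 < j)%N -> top_mnm (mxvec_index i j) = f.
Proof.
move=> i_lt2 j_gt0; rewrite !(mnmDE, mulmnE) agens_mnmE i_lt2 j_gt0 mul1n.
rewrite !mnm1E !mxvec_index_eq -!val_eqE /= !(gtn_eqF i_lt2) /=.
by rewrite (ltn_eqF j_gt0) !andbF.
Qed.

Lemma top_mnm_corner :
  [/\ top_mnm (mxvec_index i0 i0) = e, top_mnm (mxvec_index i1 i0) = e,
      top_mnm (mxvec_index i2 i1) = e & top_mnm (mxvec_index i2 i2) = e].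
Proof.
by split; rewrite !(mnmDE, mulmnE) agens_mnmE !mnm1E !mxvec_index_eq -!val_eqE
  /= mul1n mul0n addn0.
Qed.

Lemma prod_agens_corner : exists w : ZX n, \prod_(y <- agens n) y =
  xvar i0 i1 * xvar i0 i2 * xvar i1 i1 * xvar i1 i2 * w.
Proof.
rewrite prod_agens (bigD1 i0) // (bigD1 i1) //=.
rewrite (bigD1 i1) // (bigD1 i2) //= [in X in _ * (X * _)](bigD1 i1) //.
rewrite [in X in _ * (_ * X * _)](bigD1 i2) //=.
set w0 := \prod_(j | _) xvar i0 j; set w1 := \prod_(j | _) xvar i1 j.
set w2 := \prod_(i | _) _.
by exists (w0 * w1 * w2); ring.
Qed.

End Specialization.

(** * Nonvanishing modulo p and the conclusion *)

Lemma phi_p_det_not_in_ideal m q k : prime q.+2 ->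
  ~ in_ideal ([:: \det (Xmat m.+3); q.+2%:R]
              ++ [seq y ^+ (q.+2 + k) | y <- agens m.+3])
             ((\prod_(y <- agens m.+3) y) ^+ k * phi_p q.+2 (\det (Xmat m.+3))).
Proof.
move=> p_pr; set p := q.+2; set Y := \prod_(y <- _) y.
pose M := top_mnm m (q.+1).*2 (q.+1 + k).
pose i0 : 'I_m.+3 := Ordinal (isT : 0 < m.+3)%N.
pose i1 : 'I_m.+3 := Ordinal (isT : 1 < m.+3)%N.
pose i2 : 'I_m.+3 := Ordinal (isT : 2 < m.+3)%N.
pose a := xvar i0 i0; pose b := xvar i1 i0; pose x := xvar i2 i1.
pose y := xvar i2 i2; pose u1 := xvar i0 i1; pose u2 := xvar i0 i2.
pose v1 := xvar i1 i1; pose v2 := xvar i1 i2.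
have [w Yw] : exists w, Y = u1 * u2 * v1 * v2 * w by exact: prod_agens_corner.
pose D := b * x * u2 + a * y * v1 - b * y * u1 - a * x * v2.
pose sg := @matrix_subst m.+3 (special_mx m).
have sgM s t : sg (s * t) = sg s * sg t := rmorphM _ _ _.
have sgA s t : sg (s + t) = sg s + sg t := raddfD _ _ _.
have sgB s t : sg (s - t) = sg s - sg t := raddfB _ _ _.
have sgX s d : sg (s ^+ d) = sg s ^+ d := rmorphXn _ _ _.
have sgn d : sg d%:R = d%:R := rmorph_nat _ _.
have sgD : sg (\det (Xmat m.+3)) = D.
  by rewrite [LHS]matrix_subst_det det_special_mx.
pose J d := coef_dvd M d; have idJ d : ideal_pred (J d) := coef_dvd_ideal M d.
have JX d (i j : 'I_m.+3) : (i < 2)%N -> (0 < j)%N -> J d (xvar i j ^+ (p + k)).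
  by move=> li lj; apply: coef_dvd_Xn; rewrite /M top_mnm_agens.
have sgY z : z \in agens m.+3 -> sg z = z.
  by case/agensP => i [j [li _ ->]]; rewrite [LHS]matrix_subst_xvar mxE li.
have sgYk : sg Y = Y.
  rewrite /Y [LHS]rmorph_prod !big_seq; apply: eq_bigr => z; exact: sgY.
pose g := multiplier q a b x y u1 u2 v1 v2 * w ^+ q.+1.
have JgD : J p (g * D).
  rewrite /g mulrAC; apply: (ideal_predMr (idJ _)).
  have [Ma Mb Mx My] := top_mnm_corner m (q.+1).*2 (q.+1 + k).
  apply: (@multiplier_kills _ q a b x y u1 u2 v1 v2 _ (idJ p)) => //.
    exact: coef_dvd_nat.
  - by apply: coef_dvd_Xn; rewrite Ma.
  - by apply: coef_dvd_Xn; rewrite Mb.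
  - by apply: coef_dvd_Xn; rewrite Mx.
  - by apply: coef_dvd_Xn; rewrite My.
(* A colon-type ideal containing all generators: the determinant, since g D is in [J p] and so p g D
   is in [J (p * p)]; p, since p p = p^2; and the powers z^(p+k), which [sg] fixes and J
   contains. *)
pose I h := J (p * p)%N (g * sg (p%:R * h)).
have idI : ideal_pred I.
  have [J0 JD JM] := idJ (p * p)%N.
  split=> [|h1 h2 I1 I2|c h Ih]; rewrite /I.
  - by rewrite mulr0 [sg 0]raddf0 mulr0.
  - by rewrite mulrDr sgA mulrDr; apply: JD.
  - by rewrite mulrCA sgM mulrCA; apply: JM.
move/(in_ideal_sub idI) => H.
have {}H : I (Y ^+ k * phi_p p (\det (Xmat m.+3))).
  apply: H => h; rewrite mem_cat !inE => /orP[/orP[]/eqP->|/mapP[z zA ->]].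
  - rewrite /I sgM sgn sgD mulrCA.
    exact: coef_dvd_natM.
  - rewrite /I -natrM sgn.
    by apply: (ideal_predM (idJ _)); exact: coef_dvd_nat.
  - rewrite /I sgM sgX (sgY z) // mulrA.
    apply: (ideal_predM (idJ _)).
    by case/agensP: zA => i [j [li lj ->]]; apply: JX.
have JL : J (p * p)%N (sg (Y ^+ k * Lambda p (\det (Xmat m.+3)))).
  have idL : ideal_pred (fun h => J (p * p)%N (sg h)).
    have [J0 JD JM] := idJ (p * p)%N.
    split=> [|h1 h2 I1 I2|c h Ih].
    - by rewrite [sg 0]raddf0.
    - by rewrite sgA; apply: JD.
    - by rewrite sgM; apply: JM.
  apply: (Lambda_det_ideal _ idL) => // z zA.
  rewrite sgM !sgX (sgY z) // sgYk.
  (* Since z divides Y, the product Y^k z^p is a multiple of z^(p+k). *)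
  have [r ->] : exists r, Y = r * z.
    rewrite /Y (big_rem z) //=; eexists; exact: mulrC.
  rewrite exprMn -mulrA -exprD addnC; apply: (ideal_predM (idJ _)).
  by case/agensP: zA => i [j [li lj ->]]; apply: JX.
(* As p phi_p(det) = Lambda(det) - det^p and the Lambda part is already in J, the power D^p
   remains. *)
have {}H : J (p * p)%N (Y ^+ k * (g * D ^+ p)).
  rewrite [X in J _ X](_ : _ =
     g * sg (Y ^+ k * Lambda p (\det (Xmat m.+3)))
     - g * sg (p%:R * (Y ^+ k * phi_p p (\det (Xmat m.+3))))).
    by apply: (ideal_predB (idJ _)) => //; apply: (ideal_predM (idJ _)).
  rewrite [p%:R * _]mulrCA phi_pE // -mulrBr -sgB -mulrBr subKr.
  by rewrite sgM !sgX sgYk sgD; ring.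
have top : J (p * p)%N (((q.+1).*2.+1 * 'C((q.+1).*2, q.+1))%:R * 'X_[M]).
  apply: (ideal_pred_subr (idJ _) (ideal_predN (idJ _) H)); rewrite opprK.
  rewrite addrC /M top_mnmE -/Y Yw.
  by apply: (@multiplier_top_term_ext _ q a b x y u1 u2 v1 v2 k _ (idJ _) w);
    exact: JX.
by move/coef_dvd_top: top; apply/negP/prime_sqr_ndvd_top_coef.
Qed.

(* R = Z[X]/(det X); the class c = [phi_p(det X)/(x_12...x_1n x_22...x_2n)^p]
   in H^{2n-2}_a(R).  Conclusions: (1) c is nonzero, (2) p*c = 0,
   (3) the image of c in H^{2n-2}_a(R/pR) (R/pR = Z[X]/(det X, p)) is nonzero. *)
Theorem theorem7p1 (n p : nat) (hn : (3 <= n)%N) (hp : prime p) :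
  let detX := \det (Xmat n) in
  let c := phi_p p detX in
  ~ top_cech_class_zero [:: detX] (agens n) c p /\
  top_cech_class_zero [:: detX] (agens n) (p%:R * c) p /\
  ~ top_cech_class_zero [:: detX; p%:R] (agens n) c p.
Proof.
move=> detX c.
have nz : ~ top_cech_class_zero [:: detX; p%:R] (agens n) c p.
  rewrite /c /detX; clear c detX; case: n hn => [|[|[|m]]] // _.
  by case: p hp => [|[|q]] // p_pr [k]; apply: phi_p_det_not_in_ideal.
split; [|split=> //].
  (* Vanishing in R implies vanishing in R/pR, where p is one more relation. *)
  move=> [k zk]; apply: nz; exists k.
  apply: (in_ideal_sub (in_ideal_pred _) _ zk) => g; rewrite mem_cat => gG.
  by apply: in_ideal_mem; rewrite mem_cat !inE; case/orP: gG => [|->];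
    rewrite ?inE ?orbT // => ->.
(* The torsion relation already holds at stage t = p: both Lambda(det) and det^p lie in the
   ideal. *)
exists 0%N; rewrite expr0 mul1r addn0 phi_pE //.
have idI := in_ideal_pred ([:: detX] ++ [seq y ^+ p | y <- agens n]).
apply: (ideal_predB idI).
  rewrite -[Lambda _ _]mul1r; apply: Lambda_det_ideal => //; first exact: ltnW.
  move=> y yA; rewrite mul1r; apply: in_ideal_mem.
  by rewrite mem_cat (map_f (fun y => y ^+ p)) ?orbT.
have -> : detX ^+ p = detX ^+ p.-1 * detX by rewrite -exprSr prednK ?prime_gt0.
apply: (ideal_predM idI).
by apply: in_ideal_mem; rewrite !inE eqxx.
Qed.
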